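(* Let $M=(S,P,I,AP,L)$ be a generalized possibilistic Kripke structure. Then the function $Po:2^{Paths(M)}\to[0,1]$ is a generalized possibility measure in the following sense: (1) $Po(\emptyset)=0$ and $Po(Paths(M))=\bigvee_{s\in S}I(s)\wedge r_P(s)$; (2) $Po\left(\bigcup_{i\in K}A_i\right)=\bigvee_{i\in K}Po(A_i)$ for every family $\{A_i\}_{i\in K}$ of subsets of $Paths(M)$.
   Context: A generalized possibilistic Kripke structure (GPKS) is a tuple $M=(S,P,I,AP,L)$ where $S$ is a countable nonempty set of states, $P:S\times S\to[0,1]$ and $I:S\to[0,1]$ are arbitrary functions (no normalization required), $AP$ is a set of atomic propositions and $L:S\times AP\to[0,1]$. $\vee,\wedge$ denote supremum and infimum in $[0,1]$ (supremum of the empty set is $0$). A path of $M$ is an infinite sequence $\pi=s_0s_1s_2\cdots$ of states with $P(s_i,s_{i+1})>0$ for all $i\ge0$; $Paths(M)$ is the set of all paths. For $\pi=s_0s_1\cdots\in Paths(M)$, $Po(\pi)=I(s_0)\wedge\bigwedge_{i\ge0}P(s_i,s_{i+1})$, and for $E\subseteq Paths(M)$, $Po(E)=\bigvee\{Po(\pi)\mid\pi\in E\}$. The function $r_P:S\to[0,1]$ is $r_P(s)=\bigvee\{P(s,s_1)\wedge P(s_1,s_2)\wedge\cdots\mid s_1,s_2,\ldots\in S\}$. *)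

(* Defs.v *)
From mathcomp Require Import all_boot all_order all_algebra.
From mathcomp Require Import all_classical all_reals.

Set Implicit Arguments.
Unset Strict Implicit.
Unset Printing Implicit Defensive.

Import Order.TTheory GRing.Theory Num.Theory.
Local Open Scope classical_set_scope.
Local Open Scope ring_scope.

(** Suprema and infima in [0,1] are the library's [sup] and [inf] of sets of
    reals: the sets at hand are contained in [0,1], [sup set0 = 0] is the
    convention for the empty join, and [inf] is only taken over nonempty
    sets. *)

Record GPKS (R : realType) := MkGPKS {
  state : Type;
  trans : state -> state -> R;
  init : state -> R;
  atom : Type;
  label : state -> atom -> R;
  state_countable : countable [set: state];
  state_nonempty : [set: state] !=set0;
  trans_itv : forall s t, 0 <= trans s t <= 1;
  init_itv : forall s, 0 <= init s <= 1;
  label_itv : forall s a, 0 <= label s a <= 1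
}.

Record Paths (R : realType) (M : GPKS R) := MkPath {
  path_seq :> nat -> state M;
  path_trans_gt0 : forall i, 0 < trans (path_seq i) (path_seq i.+1)
}.

Section Possibility.
Variables (R : realType) (M : GPKS R).

Definition trans_meet (sigma : nat -> state M) : R :=
  inf (range (fun i => trans (sigma i) (sigma i.+1))).

Definition path_Po (pi : Paths M) : R :=
  Num.min (init (pi 0%N)) (trans_meet pi).

Definition Po (E : set (Paths M)) : R := sup [set path_Po pi | pi in E].

(** The join ranges over all state sequences issued from [s], including those
    that use a transition of possibility 0 and so are not paths. *)
Definition r_P (s : state M) : R :=
  sup [set trans_meet sigma | sigma in [set sigma | sigma 0%N = s]].

End Possibility.

(* Main.v *)
Require Import Defs.
From mathcomp Require Import all_boot all_order all_algebra.
From mathcomp Require Import all_classical all_reals.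

Local Open Scope classical_set_scope.
Local Open Scope ring_scope.

Import Order.TTheory GRing.Theory Num.Theory.

(** [Po] is a join of path values, so its value at a union is a join of joins ([Po_bigcup]), and at
    the empty set it is the empty join. The substance is [Po_setT], because [r_P] also admits
    sequences that are not paths. Each path is a sequence from its first state, which gives one
    inequality. Conversely, a sequence with positive meet is a path, so the additional sequences
    contribute only 0 and cannot raise the join. *)

(* The hypothesis [0 <= y] covers the empty set, whose [sup] is [0]. *)
Lemma sup_le_nneg {R : realType} {E : set R} {y : R} :
  0 <= y -> ubound E y -> sup E <= y.
Proof.
move=> y0 Ey; have [->|E0] := eqVneq E set0; first by rewrite sup0.
by apply: ge_sup => //; apply/set0P.
Qed.

(** The real [sup] takes a default value on unbounded sets, so bounding a member by a supremum
    always needs this. *)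
Lemma has_ubound_itv01 {R : realType} {E : set R} :
  (forall x, E x -> 0 <= x <= 1) -> has_ubound E.
Proof. by move=> E01; exists 1 => x /E01/andP[]. Qed.

Lemma sup_itv01 {R : realType} {E : set R} :
  (forall x, E x -> 0 <= x <= 1) -> 0 <= sup E <= 1.
Proof.
move=> E01; apply/andP; split; last by apply: sup_le_nneg => // x /E01/andP[].
have [->|/set0P[x Ex]] := eqVneq E set0; first by rewrite sup0.
have /andP[x0 _] := E01 x Ex.
exact: le_trans x0 (ub_le_sup (has_ubound_itv01 E01) Ex).
Qed.

Lemma min_itv01 {R : realType} {x y : R} :
  0 <= x <= 1 -> 0 <= y <= 1 -> 0 <= Num.min x y <= 1.
Proof. by move=> /andP[x0 x1] /andP[y0 y1]; rewrite le_min x0 y0 ge_min x1. Qed.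

Section Possibility.
Context {R : realType} {M : GPKS R}.

Lemma trans_meet_le (sigma : nat -> state M) (i : nat) :
  trans_meet sigma <= trans (sigma i) (sigma i.+1).
Proof.
apply: ge_inf; last by exists i.
by exists 0 => _ [j _ <-]; have /andP[] := trans_itv (sigma j) (sigma j.+1).
Qed.

Lemma trans_meet_itv (sigma : nat -> state M) : 0 <= trans_meet sigma <= 1.
Proof.
apply/andP; split.
  apply: lb_le_inf; first by exists (trans (sigma 0%N) (sigma 1%N)), 0%N.
  by move=> _ [j _ <-]; have /andP[] := trans_itv (sigma j) (sigma j.+1).
have /andP[_] := trans_itv (sigma 0%N) (sigma 1%N).
exact: le_trans (trans_meet_le sigma 0).
Qed.

Lemma path_Po_itv (pi : Paths M) : 0 <= path_Po pi <= 1.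
Proof. by apply: min_itv01; [exact: init_itv|exact: trans_meet_itv]. Qed.

Lemma Po_itv (E : set (Paths M)) : 0 <= Po E <= 1.
Proof. by apply: sup_itv01 => _ [pi _ <-]; exact: path_Po_itv. Qed.

Lemma Po_ge0 (E : set (Paths M)) : 0 <= Po E.
Proof. by have /andP[] := Po_itv E. Qed.

Lemma path_Po_le {E : set (Paths M)} (pi : Paths M) : E pi -> path_Po pi <= Po E.
Proof.
move=> Epi; apply: ub_le_sup; last by exists pi.
by apply: has_ubound_itv01 => _ [pi' _ <-]; exact: path_Po_itv.
Qed.

Lemma Po_le {E : set (Paths M)} {y : R} :
  0 <= y -> (forall pi, E pi -> path_Po pi <= y) -> Po E <= y.
Proof. by move=> y0 Ey; apply: sup_le_nneg => // _ [pi /Ey Epi <-]. Qed.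

Lemma r_P_itv (s : state M) : 0 <= r_P s <= 1.
Proof. by apply: sup_itv01 => _ [sigma _ <-]; exact: trans_meet_itv. Qed.

Lemma trans_meet_le_r_P (sigma : nat -> state M) :
  trans_meet sigma <= r_P (sigma 0%N).
Proof.
apply: ub_le_sup; last by exists sigma.
by apply: has_ubound_itv01 => _ [? _ <-]; exact: trans_meet_itv.
Qed.

Lemma Po_setT :
  Po [set: Paths M] = sup (range (fun s : state M => Num.min (init s) (r_P s))).
Proof.
have rng01 x : range (fun s : state M => Num.min (init s) (r_P s)) x ->
    0 <= x <= 1.
  by move=> [s _ <-]; apply: min_itv01; [exact: init_itv|exact: r_P_itv].
apply/eqP; rewrite eq_le; apply/andP; split.
  (* [M] may have no path at all; the left side is then 0, hence the nonnegativity goal. *)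
  apply: Po_le => [|pi _]; first by have /andP[] := sup_itv01 rng01.
  apply: (@le_trans _ _ (Num.min (init (pi 0%N)) (r_P (pi 0%N)))).
    by rewrite le_min !ge_min lexx trans_meet_le_r_P orbT.
  by apply: ub_le_sup; [exact: has_ubound_itv01|exists (pi 0%N)].
apply: sup_le_nneg (Po_ge0 _) _ => _ [s _ <-].
(* The supremum in [r_P s] need not be attained. Arguing by contradiction, a strict excess over [Po]
   passes to both [init s] and [r_P s], then to some sequence approximating [r_P s]; this replaces
   distributivity of the meet over the join. *)
rewrite leNgt; apply/negP; rewrite lt_min => /andP[Po_init Po_r].
(* A sequence whose meet exceeds [Po setT >= 0] only uses transitions of
   positive possibility, hence is a path. *)
have [_ [sigma /= sigma0 <-] Po_meet] : exists2 x,
    [set trans_meet sigma | sigma in [set sigma | sigma 0%N = s]] x &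
    Po [set: Paths M] < x.
  (* The constant sequence only shows that the set of meets is nonempty; it need not be a path. *)
  by apply: sup_gt => //; exists (trans_meet (fun=> s)), (fun=> s).
have sigma_gt0 i : 0 < trans (sigma i) (sigma i.+1).
  apply: lt_le_trans (trans_meet_le sigma i).
  exact: le_lt_trans (Po_ge0 _) Po_meet.
have := @path_Po_le setT (MkPath sigma_gt0) Logic.I.
by rewrite leNgt lt_min /= sigma0 Po_init Po_meet.
Qed.

Lemma Po_bigcup (K : Type) (A : K -> set (Paths M)) :
  Po (\bigcup_(i in [set: K]) A i) = sup (range (fun i : K => Po (A i))).
Proof.
have rng01 x : range (fun i : K => Po (A i)) x -> 0 <= x <= 1.
  by move=> [i _ <-]; exact: Po_itv.
apply/eqP; rewrite eq_le; apply/andP; split.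
  apply: Po_le => [|pi [i _ Ai]]; first by have /andP[] := sup_itv01 rng01.
  apply: le_trans (path_Po_le _ Ai) _.
  by apply: ub_le_sup; [exact: has_ubound_itv01|exists i].
(* Nonnegativity of [Po] settles an empty [K] here and an empty [A i] on the next line. *)
apply: sup_le_nneg (Po_ge0 _) _ => _ [i _ <-].
by apply: Po_le (Po_ge0 _) _ => pi Ai; apply: path_Po_le; exists i.
Qed.

End Possibility.

Theorem theorem2 (R : realType) (M : GPKS R) :
  (forall E : set (Paths M), 0 <= Po E <= 1) /\
  (Po (set0 : set (Paths M)) = 0 /\
   Po [set: Paths M] = sup (range (fun s : state M => Num.min (init s) (r_P s)))) /\
  (forall (K : Type) (A : K -> set (Paths M)),
     Po (\bigcup_(i in [set: K]) A i) = sup (range (fun i : K => Po (A i)))).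
Proof.
split; first exact: Po_itv.
split; last exact: Po_bigcup.
by split; [rewrite /Po image_set0 sup0|exact: Po_setT].
Qed.
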